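(* Let $G$ be a finitely generated amenable group with finite symmetric generating set $P$, possessing a strictly increasing, tempered Følner sequence $(Q_n)$ of monotiles. Let $p\in\ell^1(G)$ satisfy $0\le p(x)\le1$ and $p(x)=p(x^{-1})$ for all $x\in G$, let $(\Omega,\mathcal A,\mathbb P)$ be the associated long-range percolation probability space, let $\Delta_\omega$ be the Laplacian of the random graph $\Gamma_\omega$, and let $N$ be the integrated density of states. Then there exists a set $\tilde\Omega\subset\Omega$ of full measure such that for each $\omega\in\tilde\Omega$ and each $\lambda\in\mathbb R$ the following assertions are equivalent: (a) $\lambda$ is a point of discontinuity of $N$; (b) there exists a finitely supported eigenfunction of $\Delta_\omega$ corresponding to $\lambda$; (c) there exist infinitely many linearly independent finitely supported eigenfunctions of $\Delta_\omega$ corresponding to $\lambda$.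
   Context: Metric. For $g,h\in G$, $d(g,h)$ is the least $L\in\mathbb N_0$ such that $gh^{-1}$ is a product of $L$ elements of $P$. Sequences of sets. A Følner sequence is a sequence $(Q_n)$ of nonempty finite subsets of $G$ with $\lim_{n\to\infty}|KQ_n\setminus Q_n|/|Q_n|=0$ for every finite $K\subset G$. It is tempered if there is $C>0$ with $|\bigcup_{k<n}Q_k^{-1}Q_n|\le C|Q_n|$ for all $n$, and strictly increasing if $|Q_{n+1}|>|Q_n|$ for all $n$. A finite set $Q\subset G$ is a monotile of $G$ if there is $T\subset G$ such that $G$ is the disjoint union of the sets $Qt$, $t\in T$. Percolation. Let $E$ be the edge set of the complete undirected graph $\Gamma$ with vertex set $G$; an edge is an unordered pair $[x,y]$ of distinct elements of $G$. Set $\Omega=\{0,1\}^E$, $\mathcal A$ the $\sigma$-algebra generated by cylinder sets, and $\mathbb P=\prod_{e\in E}\mathbb P_e$ the product measure with $\mathbb P_e(\omega(e)=1)=p(xy^{-1})$ and $\mathbb P_e(\omega(e)=0)=1-p(xy^{-1})$ for $e=[x,y]$. For $\omega\in\Omega$ let $E_\omega=\{e\in E:\omega(e)=1\}$, $\Gamma_\omega=(G,E_\omega)$, and $m_\omega(x)=|\{y\in G:[x,y]\in E_\omega\}|$. For almost every $\omega$, $\Gamma_\omega$ is locally finite ($m_\omega(x)<\infty$ for all $x$). Laplacian. For $\omega$ with $\Gamma_\omega$ locally finite, $\Delta_\omega:D_\omega\to\ell^2(G)$ is the unique selfadjoint extension of the essentially selfadjoint operator $\tilde\Delta_\omega f(x)=\sum_{y:[x,y]\in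 E_\omega}(f(x)-f(y))$ defined on finitely supported functions $f:G\to\mathbb C$. For finite $Q\subset G$, $\Delta_\omega[Q]$ is its restriction to $\ell^2(Q)$ (matrix with diagonal entries $m_\omega(x)$, entry $-1$ at $(x,y)$ if $[x,y]\in E_\omega$, and $0$ otherwise). Integrated density of states. For a selfadjoint operator $A$ on a finite dimensional Hilbert space, $n(A)(E)$ is the number of eigenvalues of $A$, counted with multiplicity, that are $\le E$. The integrated density of states $N:\mathbb R\to\mathbb R$ is the non-random function which, for almost every $\omega$, is the limit in supremum norm of $n(\Delta_\omega[Q_j])/|Q_j|$ as $j\to\infty$. Equivalently it is the supremum-norm limit as $n\to\infty$ of $|Q_n|^{-1}\sum_{S}\nu_S\,n(\Delta_S)$, where the sum is over all subgraphs $S=(Q_n,E_S)$ of $\Gamma$ with vertex set $Q_n$, $\Delta_Sf(x)=\sum_{y\in Q_n:[x,y]\in E_S}(f(x)-f(y))$, and $\nu_S=\prod_{[x,y]\in E_S}p(xy^{-1})\prod_{[x,y]\in E\setminus E_S,\ x,y\in Q_n}(1-p(xy^{-1}))$. These limits are known to exist and to coincide almost surely. *)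

(* Defs.v *)
From HB Require Import structures.
From mathcomp Require Import all_boot all_order all_algebra finmap complex.
From mathcomp Require Import all_classical all_reals all_analysis.
From mathcomp.analysis.showcase Require summability.

Set Implicit Arguments.
Unset Strict Implicit.
Unset Printing Implicit Defensive.

Import Order.TTheory GRing.Theory Num.Theory.
Import numFieldNormedType.Exports.

Local Open Scope classical_set_scope.
Local Open Scope ring_scope.

Definition mulfset (G : groupType) (A B : {fset G}) : {fset G} :=
  [fset (a * b)%g | a in A, b in B]%fset.

Definition invfset (G : groupType) (A : {fset G}) : {fset G} :=
  [fset (a^-1)%g | a in A]%fset.

Definition symmetric_generating_set (G : groupType) (S : {fset G}) : Prop :=
  (forall x, x \in S -> (x^-1)%g \in S) /\
  (forall x : G, exists s : seq G, all (mem S) s /\ x = (\prod_(y <- s) y)%g).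

Definition folner (R : realType) (G : groupType) (Q : nat -> {fset G}) : Prop :=
  (forall n, Q n != fset0) /\
  (forall K : {fset G},
     (fun n => #|` (mulfset K (Q n) `\` Q n)%fset|%:R / #|` Q n|%:R : R)
       @ \oo --> (0 : R)).

Definition amenable (R : realType) (G : groupType) : Prop :=
  exists Q : nat -> {fset G}, folner R Q.

Definition tempered (R : realType) (G : groupType) (Q : nat -> {fset G})
  : Prop :=
  exists2 C : R, 0 < C & forall n,
    #|` (\bigcup_(k <- iota 0 n) mulfset (invfset (Q k)) (Q n))%fset|%:R
      <= C * #|` Q n|%:R.

Definition strictly_increasing (G : groupType) (Q : nat -> {fset G}) : Prop :=
  forall n, (#|` Q n| < #|` Q n.+1|)%N.

Definition monotile (G : groupType) (Q : {fset G}) : Prop :=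
  exists T : set G,
    let tile t := [set (q * t)%g | q in [set` Q]] in
    trivIset T tile /\ \bigcup_(t in T) tile t = [set: G].

Definition edge (G : groupType) := {e : {fset G} | #|` e| == 2}.

Definition configuration (G : groupType) := edge G -> bool.

Definition cylinder (G : groupType) (F : {fset edge G})
    (eta : configuration G) : set (configuration G) :=
  [set omega | forall e, e \in F -> omega e = eta e].

Definition cylinders (G : groupType) : set (set (configuration G)) :=
  [set A | exists F eta, A = cylinder F eta].

Notation Omega G := (g_sigma_algebraType (@cylinders G)).

(* [e] is enumerated as [:: x; y] in an unspecified order; this is harmless
   when p x = p x^-1. *)
Definition edge_prob (R : realType) (G : groupType) (p : G -> R) (e : edge G)
    : R :=
  let x := nth 1%g (val e) 0 in
  let y := nth 1%g (val e) 1 in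
  p (x * y^-1)%g.

(* A probability measure on [Omega G] is determined by its values on the
   cylinders, which form a generating pi-system. *)
Definition product_measure (R : realType) (G : groupType) (p : G -> R)
    (Pr : probability (Omega G) R) : Prop :=
  forall (F : {fset edge G}) (eta : configuration G),
    Pr (cylinder F eta) =
    (\prod_(e <- F) (if eta e then edge_prob p e else 1 - edge_prob p e))%:E.

(* [x, y] is an open edge; always false for x = y, as [fset x; y] is then not
   an edge. *)
Definition adj (G : groupType) (omega : configuration G) (x y : G) : bool :=
  if insub [fset x; y]%fset is Some e then omega e else false.

Definition nbrs (G : groupType) (omega : configuration G) (x : G) : set G :=
  [set y | adj omega x y].

Definition locally_finite (G : groupType) (omega : configuration G) : Prop :=
  forall x, finite_set (nbrs omega x).

Definition degree (G : groupType) (omega : configuration G) (x : G) : nat :=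
  #|` fset_set (nbrs omega x)|.

Definition ell2 (R : realType) (G : groupType) (f : G -> R[i]) : Prop :=
  esum.summable [set: G] (fun x => (ComplexField.Normc.normc (f x) ^+ 2)%:E).

Definition real_sum (R : realType) (G : groupType) (u : G -> R) : R :=
  summability.sum (u : G -> R^o).

Definition inner (R : realType) (G : groupType) (f g : G -> R[i]) : R[i] :=
  (real_sum (fun x => complex.Re (f x * (g x)^*%C))
   +i* real_sum (fun x => complex.Im (f x * (g x)^*%C)))%C.

(* The values of [app] outside [dom] are irrelevant. *)
Record operator (R : realType) (G : groupType) := Operator {
  dom : set (G -> R[i]);
  app : (G -> R[i]) -> (G -> R[i]) }.

Definition linear_operator (R : realType) (G : groupType) (A : operator R G)
    : Prop :=
  [/\ forall f, dom A f -> ell2 f /\ ell2 (app A f),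
      dom A (fun=> 0)
    & forall (a : R[i]) f g, dom A f -> dom A g ->
        dom A (fun x => a * f x + g x) /\
        app A (fun x => a * f x + g x) = (fun x => a * app A f x + app A g x)].

Definition densely_defined (R : realType) (G : groupType) (A : operator R G)
    : Prop :=
  forall g, ell2 g -> forall eps : R, 0 < eps -> exists2 f, dom A f &
    (\esum_(x in [set: G])
       (ComplexField.Normc.normc (g x - f x) ^+ 2)%:E < eps%:E)%E.

(* A = A^*: the pairs (g, h) with <A f, g> = <f, h> for all f in the domain are
   exactly the pairs (g, A g) with g in the domain. *)
Definition selfadjoint (R : realType) (G : groupType) (A : operator R G)
    : Prop :=
  [/\ linear_operator A, densely_defined A
    & forall g h, ell2 g -> ell2 h ->
        (forall f, dom A f -> inner (app A f) g = inner f h) <->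
        (dom A g /\ h = app A g)].

Definition extends (R : realType) (G : groupType) (A B : operator R G)
    : Prop :=
  forall f, dom A f -> dom B f /\ app B f = app A f.

Definition finitely_supported (R : realType) (G : groupType) (f : G -> R[i])
    : Prop :=
  finite_set [set x | f x != 0].

Definition minimal_laplacian (R : realType) (G : groupType)
    (omega : configuration G) : operator R G :=
  Operator (@finitely_supported R G)
    (fun f x => \sum_(y <- fset_set (nbrs omega x)) (f x - f y)).

Definition is_laplacian (R : realType) (G : groupType)
    (omega : configuration G) (A : operator R G) : Prop :=
  selfadjoint A /\ extends (minimal_laplacian R omega) A.

Definition laplacian_mx (R : realType) (G : groupType)
    (omega : configuration G) (Q : {fset G}) : 'M[R[i]]_(#|` Q|) :=
  \matrix_(i, j)
    let x := nth 1%g Q i in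
    let y := nth 1%g Q j in
    if x == y then (degree omega x)%:R
    else if adj omega x y then -1 else 0.

(* Only the finitely many eigenvalues mu contribute.  For selfadjoint A, all
   eigenvalues are real and the multiplicity of mu is the dimension of its
   eigenspace. *)
Definition eigenvalue_count (R : realType) (n : nat) (A : 'M[R[i]]_n) (E : R)
    : R :=
  \sum_(mu \in [set mu : R | mu <= E]) ((\rank (eigenspace A mu%:C%C))%:R : R).

Definition integrated_density_of_states (R : realType) (G : groupType)
    (Q : nat -> {fset G}) (Pr : probability (Omega G) R) (N : R -> R) : Prop :=
  {ae Pr, forall omega,
    {uniform, (fun j E => eigenvalue_count (laplacian_mx R omega (Q j)) E
                          / #|` Q j|%:R : R) @ \oo --> N}}.

Definition finitely_supported_eigenfunction (R : realType) (G : groupType)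
    (A : operator R G) (lambda : R) (f : G -> R[i]) : Prop :=
  [/\ finitely_supported f, f <> (fun=> 0), dom A f
    & app A f = (fun x => lambda%:C%C * f x)].

Definition linearly_independent (R : realType) (G : groupType)
    (f : nat -> G -> R[i]) : Prop :=
  forall (n : nat) (c : 'I_n -> R[i]),
    (forall x, \sum_(k < n) c k * f k x = 0) -> forall k, c k = 0.

(* Main.v *)
Require Import Defs.
From HB Require Import structures.
From mathcomp Require Import all_boot all_order all_algebra finmap complex.
From mathcomp Require Import all_classical all_reals all_analysis.
From mathcomp Require Import measurable_realfun ring lra.

Set Implicit Arguments.
Unset Strict Implicit.
Unset Printing Implicit Defensive.

Import Order.TTheory GRing.Theory Num.Theory.
Import numFieldNormedType.Exports.

Local Open Scope classical_set_scope.
Local Open Scope ring_scope.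

(** Fix lambda and write m_j(omega) for the multiplicity of lambda as an eigenvalue of the matrix
Delta_omega[Q_j]. The jump at lambda of the normalized counting function of this matrix is
m_j(omega) / |Q_j|, and uniform limits preserve jumps; hence, for almost every omega, N is
discontinuous at lambda exactly when m_j(omega) / |Q_j| does not tend to 0, and then it even stays
bounded away from 0 ([discontinuous_multiplicity], [continuous_multiplicity]). Since N does not
depend on omega, it is enough to compare multiplicities with finitely supported eigenfunctions.
Note that any selfadjoint extension of the Laplacian acts on finitely supported functions by the
explicit formula, so that these eigenfunctions are a purely combinatorial matter.

Discontinuity produces eigenfunctions. An eigenvector of Delta_omega[Q_j], extended by zero, is an
eigenfunction of Delta_omega as soon as it vanishes at the vertices of Q_j which have a neighbour
outside Q_j, which amounts to at most that many linear conditions. Such a vertex is either moved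
out of Q_j by one of finitely many fixed group elements, which concerns a small proportion of Q_j
by the Folner property, or it is the endpoint of a long open edge. As p is summable, a
vertex is the endpoint of a long edge with small probability, so by the Markov inequality and
continuity of the measure, almost surely only a small proportion of Q_j is concerned for infinitely
many j ([ae_few_long_edges]). If m_j >= c |Q_j|, there is room left to vanish on any prescribed
finite set as well, which gives infinitely many eigenfunctions with pairwise disjoint supports
([discontinuous_eigenfunctions]).

An eigenfunction produces a discontinuity. An eigenfunction f of Delta_omega0 supported in B depends
on omega0 only through the pattern formed by the edges touching B, of which finitely many are open.
There are countably many such patterns, so those of probability zero can be discarded, and
the pattern of omega0 has probability q > 0. This probability is invariant under right translation.
By the Markov inequality again, with positive probability at least q |Q_j| / 4 translates of the
pattern occur inside Q_j for infinitely many j. Keeping only translates of B that are disjoint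
costs a factor |B|^2, and disjointly supported translates of f are independent eigenvectors, so
that m_j >= c |Q_j| for infinitely many j ([multiplicity_ge], [eigenfunction_discontinuous]). *)

(** * Jumps of eigenvalue counting functions and of their uniform limits *)

Section EigenvalueCount.
Context {R : realType} {n : nat}.
Implicit Types (A : 'M[R[i]]_n) (mu la : R).

Definition multiplicity A mu : nat := \rank (eigenspace A mu%:C%C).

(** Real eigenvalues are real parts of roots of the characteristic polynomial. *)
Lemma finite_eigenvalues A : finite_set [set mu | multiplicity A mu != 0%N].
Proof.
have cP0 : char_poly A != 0 by rewrite monic_neq0 ?char_poly_monic.
have [rs rsE] : {rs : seq R[i] | forall z, root (char_poly A) z -> z \in rs}.
  have [rs] := closed_field_poly_normal (char_poly A).
  rewrite (monicP (char_poly_monic A)) scale1r => ->.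
  by exists rs => z; rewrite root_prod_XsubC.
apply: (@sub_finite_set _ _ [set` [seq complex.Re z | z <- rs]]); last exact: finite_seq.
move=> mu /=; rewrite mxrank_eq0 => mu_ev; apply/mapP; exists mu%:C%C => //.
by apply: rsE; rewrite -eigenvalue_root_char.
Qed.

Definition eigenvalues A : {fset R} := fset_set [set mu | multiplicity A mu != 0%N].

Lemma mem_eigenvalues A mu : (mu \in eigenvalues A) = (multiplicity A mu != 0%N).
Proof.
rewrite in_fset_set; last exact: finite_eigenvalues.
by apply/idP/idP; rewrite inE.
Qed.

Lemma eigenvalue_countE A E :
  eigenvalue_count A E =
  \sum_(mu <- eigenvalues A | mu <= E) (multiplicity A mu)%:R.
Proof.
rewrite /eigenvalue_count (fsbigE [seq mu <- eigenvalues A | mu <= E]).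
- rewrite big_filter_cond; apply: eq_bigl => mu.
  by rewrite mem_setE /= andbb.
- exact/filter_uniq/fset_uniq.
- by move=> mu /=; rewrite mem_filter => /andP[].
- move=> mu /= muE; rewrite mem_filter muE /= mem_eigenvalues negbK => /eqP.
  by rewrite /multiplicity => ->.
Qed.

Lemma eigenvalue_countB A x y : x <= y ->
  eigenvalue_count A y - eigenvalue_count A x =
  \sum_(mu <- eigenvalues A | x < mu <= y) (multiplicity A mu)%:R.
Proof.
move=> xy; apply/eqP; rewrite subr_eq !eigenvalue_countE addrC; apply/eqP.
rewrite (bigID (fun mu => mu <= x)) /=; congr (_ + _); apply: eq_bigl => mu.
  by rewrite andb_idl // => /le_trans; apply.
by rewrite -ltNge andbC.
Qed.

Lemma eigenvalue_count_jump A la x : x < la ->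
  (multiplicity A la)%:R <= eigenvalue_count A la - eigenvalue_count A x.
Proof.
move=> x_la; rewrite (eigenvalue_countB _ (ltW x_la)).
have [la0|la_ev] := eqVneq (multiplicity A la) 0%N.
  by rewrite la0 sumr_ge0.
rewrite -mem_eigenvalues in la_ev.
by rewrite (big_rem la) //= x_la lexx /= lerDl sumr_ge0.
Qed.

(** Close enough to [la] there is no other eigenvalue, so that moving the argument can change the
count only by the jump at [la] itself. *)
Lemma eigenvalue_count_local A la : exists2 d : R, 0 < d &
  forall x, `|x - la| < d ->
    `|eigenvalue_count A x - eigenvalue_count A la| <= (multiplicity A la)%:R.
Proof.
pose d := \big[Num.min/1]_(mu <- eigenvalues A | mu != la) `|mu - la|.
have d_gt0 : 0 < d.
  rewrite /d; elim/big_ind: _ => // [x y x0 y0|mu mula]; first by rewrite lt_min x0.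
  by rewrite normr_gt0 subr_eq0.
have far mu : mu \in eigenvalues A -> `|mu - la| < d -> mu = la.
  move=> muA; apply: contraTeq => mula; rewrite -leNgt.
  exact: ge_bigmin_seq.
have small x y : x <= y -> (forall z, x < z <= y -> `|z - la| < d) ->
    `|eigenvalue_count A y - eigenvalue_count A x| <= (multiplicity A la)%:R.
  move=> xy close; rewrite (eigenvalue_countB _ xy) ger0_norm ?sumr_ge0 //.
  have other mu : mu \in eigenvalues A -> x < mu <= y -> mu = la.
    by move=> muA /close; exact: far.
  have [la_ev|la_ev] := boolP (la \in eigenvalues A).
    rewrite (big_rem la) //= [X in _ + X]big1_seq ?addr0; first by case: ifP.
    move=> mu /andP[xmuy mu_rem]; have := mu_rem.
    rewrite mem_rem_uniq ?fset_uniq // inE => /andP[/eqP + _]; case.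
    by apply: other => //; exact: mem_rem mu_rem.
  rewrite big1_seq // => mu /andP[xmuy mu_ev].
  by rewrite -(other mu mu_ev xmuy) mu_ev in la_ev.
exists d => // x; have [xla|lax] := leP x la => xd.
- rewrite distrC; apply: small => // z /andP[xz zla].
  rewrite distrC ger0_norm ?subr_ge0 // (le_lt_trans _ xd) //.
  by rewrite distrC ger0_norm ?subr_ge0 // lerB // ltW.
- apply: small => [|z /andP[laz zx]]; first exact: ltW.
  rewrite gtr0_norm ?subr_gt0 // (le_lt_trans _ xd) //.
  by rewrite gtr0_norm ?subr_gt0 // lerB.
Qed.
End EigenvalueCount.

Section JumpOfLimit.
Context {R : realType} (n : nat -> nat) (A : forall j, 'M[R[i]]_(n j)) (N : R -> R).
Hypothesis n_gt0 : forall j, (0 < n j)%N.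
Hypothesis AN :
  {uniform, (fun j E => eigenvalue_count (A j) E / (n j)%:R : R) @ \oo --> N}.

Lemma uniform_near e : 0 < e -> \forall j \near \oo,
  forall E, `|eigenvalue_count (A j) E / (n j)%:R - N E| < e.
Proof.
move=> e0.
suff nbhsN : nbhs (N : {uniform` [set: R] -> R}) [set h | forall E, `|h E - N E| < e].
  exact: (AN nbhsN).
apply/uniform_nbhs; exists [set xy : R * R | ball xy.1 e xy.2].
split; first exact: (entourage_ball _ (PosNum e0)).
by move=> h /= hE E; rewrite distrC; apply: hE.
Qed.

(** If [N] oscillates by [e] near [la], so does every counting function that is uniformly close to
it, up to a loss; but near [la] a counting function oscillates at most by the multiplicity. *)
Lemma discontinuous_multiplicity la : ~ {for la, continuous N} ->
  exists2 c : R, 0 < c & \forall j \near \oo, c * (n j)%:R <= (multiplicity (A j) la)%:R.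
Proof.
move=> Ndisc; apply: contrapT => no_c; apply: Ndisc.
apply/cvgrPdist_lt => e e0.
have e4 : 0 < e / 4 by rewrite divr_gt0.
(* The bound e / 4 on the jump leaves room for two approximations of N by a counting function. *)
have not_near : ~ \forall j \near \oo, (e / 4) * (n j)%:R <= (multiplicity (A j) la)%:R.
  by move=> H; apply: no_c; exists (e / 4).
have [j [NE mult_lt]] : exists j,
    (forall E, `|eigenvalue_count (A j) E / (n j)%:R - N E| < e / 4) /\
    (multiplicity (A j) la)%:R < (e / 4) * (n j)%:R.
  apply: contrapT => noj; apply: not_near.
  near=> j; rewrite leNgt; apply/negP => mult_lt; apply: noj; exists j; split => //.
  by near: j; exact: uniform_near.
have [d d0 loc] := eigenvalue_count_local (A j) la.
near=> x.
have xd : `|x - la| < d 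
  by near: x; apply/nbhs_ballP; exists d => //= y; rewrite /ball /= distrC.
rewrite distrC.
have nj0 : 0 < (n j)%:R :> R by rewrite ltr0n.
have step : `|eigenvalue_count (A j) x / (n j)%:R - eigenvalue_count (A j) la / (n j)%:R| < e / 4.
  rewrite -mulrBl normrM normfV (gtr0_norm nj0) ltr_pdivrMr //.
  exact: le_lt_trans (loc x xd) _.
move: step (NE x) (NE la).
set a := eigenvalue_count _ la / _; set b := eigenvalue_count _ x / _.
rewrite !ltr_norml => /andP[? ?] /andP[? ?] /andP[? ?].
by apply/andP; split; lra.
Unshelve. all: by end_near. Qed.

(** The multiplicity of [la] is at most the increment of the counting function from a point below
[la] to [la], and this increment is close to the one of [N], which is small by continuity. *)
Lemma continuous_multiplicity la : {for la, continuous N} ->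
  forall c : R, 0 < c -> \forall j \near \oo, (multiplicity (A j) la)%:R < c * (n j)%:R.
Proof.
move=> Ncont c c0.
have c4 : 0 < c / 4 by rewrite divr_gt0.
have [d /= d0 Nd] : exists2 d : R, 0 < d & forall x, `|la - x| < d -> `|N la - N x| < c / 4.
  by have /cvgrPdist_lt /(_ _ c4) [d d0 H] := Ncont; exists d.
near=> j.
have NE : forall E, `|eigenvalue_count (A j) E / (n j)%:R - N E| < c / 4.
  by near: j; exact: uniform_near.
pose x := la - d / 2.
have x_la : x < la by rewrite ltrBlDr ltrDl divr_gt0.
have Nx : `|N la - N x| < c / 4.
  by apply: Nd; rewrite /x opprB addrC subrK gtr0_norm ?divr_gt0 // ltr_pdivrMr // ltr_pMr // ltr1n.
have nj0 : 0 < (n j)%:R :> R by rewrite ltr0n.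
rewrite -ltr_pdivrMr //.
apply: (@le_lt_trans _ _
  (eigenvalue_count (A j) la / (n j)%:R - eigenvalue_count (A j) x / (n j)%:R)).
  by rewrite -mulrBl ler_pM2r ?invr_gt0 //; exact: eigenvalue_count_jump.
move: Nx (NE x) (NE la).
set a := eigenvalue_count _ la / _; set b := eigenvalue_count _ x / _.
rewrite !ltr_norml => /andP[? ?] /andP[? ?] /andP[? ?].
lra.
Unshelve. all: by end_near. Qed.

End JumpOfLimit.

(** * Eigenvectors and their supports *)

Section RankLemmas.
Context {F : fieldType}.

(** Vanishing on [Z] imposes #|Z| linear conditions on the eigenspace: restricted to the columns in
[Z], a basis of the eigenspace has more rows than columns. *)
Lemma eigenvector_vanishing (n : nat) (A : 'M[F]_n) (a : F) (Z : {set 'I_n}) :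
  (#|Z| < \rank (eigenspace A a))%N ->
  exists v : 'rV[F]_n, [/\ v != 0, v *m A = a *: v & forall i, i \in Z -> v 0 i = 0].
Proof.
move=> Zlt; set E := eigenspace A a in Zlt.
pose M := colsub (fun k : 'I_#|Z| => enum_val k) (row_base E).
have : ~~ row_free M.
  by rewrite /row_free neq_ltn (leq_ltn_trans (rank_leq_col M)).
rewrite -kermx_eq0 => /rowV0Pn[u /sub_kermxP uM u0].
exists (u *m row_base E); split.
- have free := row_base_free E; apply: contra u0 => /eqP uE.
  by apply/eqP; apply: (row_free_inj free); rewrite uE mul0mx.
- by apply/eigenspaceP; rewrite (submx_trans (submxMl _ _)) ?eq_row_base.
- move=> i iZ; have := congr1 (fun w : 'rV_#|Z| => w 0 (enum_rank_in iZ i)) uM.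
  by rewrite mulmx_colsub mxE enum_rankK_in // => ->; rewrite mxE.
Qed.

Lemma rank_disjoint_supports (m n : nat) (V : 'M[F]_(m, n)) (c : 'I_m -> 'I_n) :
  (forall i, V i (c i) != 0) -> (forall i k, i != k -> V k (c i) = 0) -> \rank V = m.
Proof.
move=> Vc V0; apply/eqP/inj_row_free => v vV.
apply/rowP => i; rewrite mxE.
have := congr1 (fun w : 'rV_n => w 0 (c i)) vV.
rewrite !mxE (bigD1 i) //= big1 ?addr0 => [/eqP|k ki]; last first.
  by rewrite V0 ?mulr0 // eq_sym.
by rewrite mulf_eq0 (negPf (Vc i)) orbF => /eqP.
Qed.
End RankLemmas.

(** * The Laplacian on finitely supported functions *)

Notation laplace R omega := (app (minimal_laplacian R omega)).

Section Laplacian.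
Context {R : realType} {G : groupType}.
Implicit Types (omega : configuration G) (f : G -> R[i]) (x y : G) (B Q : {fset G}).

Lemma adjC omega x y : adj omega x y = adj omega y x.
Proof. by rewrite /adj fsetUC. Qed.

Lemma adjxx omega x : adj omega x x = false.
Proof. by rewrite /adj fsetUid insubF // cardfs1. Qed.

Lemma in_nbrs omega x y : finite_set (nbrs omega x) ->
  (y \in fset_set (nbrs omega x)) = adj omega x y.
Proof. by move=> fin; rewrite in_fset_set // mem_setE. Qed.

(** Written over the support [B] of [f] instead of the neighbours of [x], the formula involves the
configuration only through the degree and the edges into [B]. *)
Lemma laplace_supported omega B f x : finite_set (nbrs omega x) ->
  (forall y, y \notin B -> f y = 0) ->
  laplace R omega f x =
  (degree omega x)%:R * f x - \sum_(y <- B | adj omega x y) f y.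
Proof.
move=> fin fB; rewrite /= sumrB big_const_seq count_predT iter_addr addr0.
rewrite mulr_natl; congr (_ - _).
rewrite (bigID (mem B)) /= [X in _ + X]big1 ?addr0; last by move=> y /fB.
rewrite -big_filter -[RHS]big_filter; apply: perm_big.
apply: uniq_perm; rewrite ?filter_uniq ?fset_uniq // => y.
by rewrite !mem_filter in_nbrs // andbC.
Qed.

Definition restrict Q f : 'rV[R[i]]_#|` Q| := \row_i f (nth 1%g Q i).

(** The Laplacian matrix keeps the full degrees on its diagonal, so it is the compression of the
Laplacian; as it is symmetric, it may act on row vectors, as eigenspaces do here. *)
Lemma restrict_mul_laplacian omega Q f : locally_finite omega ->
  (forall y, y \notin Q -> f y = 0) ->
  restrict Q f *m laplacian_mx R omega Q = restrict Q (laplace R omega f).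
Proof.
move=> lf fQ; apply/rowP => j; rewrite [RHS]mxE (laplace_supported _ fQ) //.
set x := nth _ _ j.
have xQ : x \in Q by exact: mem_nth.
rewrite mxE (eq_bigr (fun i : 'I_#|` Q| => let y := nth 1%g Q i in
   f y * (if y == x then (degree omega y)%:R else if adj omega y x then -1 else 0))); last first.
  by move=> i _; rewrite !mxE.
rewrite -(big_mkord xpredT (fun i => let y := nth 1%g Q i in
   f y * (if y == x then (degree omega y)%:R else if adj omega y x then -1 else 0))).
rewrite -(big_nth 1%g xpredT (fun y => 
   f y * (if y == x then (degree omega y)%:R else if adj omega y x then -1 else 0))).
rewrite (big_rem x) //= eqxx mulrC; congr (_ + _).
rewrite [in RHS](big_rem x) //= adjxx add0r -sumrN [RHS]big_mkcond /=.
apply: eq_big_seq => y; rewrite mem_rem_uniq ?fset_uniq // inE => /andP[/negPf -> _].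
by rewrite adjC; case: ifP; rewrite ?mulr0 // mulrN1.
Qed.

Definition extend Q (v : 'rV[R[i]]_#|` Q|) x : R[i] :=
  if insub (index x Q) is Some i then v 0 i else 0.

Lemma extend_out Q v x : x \notin Q -> @extend Q v x = 0.
Proof. by move=> xQ; rewrite /extend insubF // index_mem (negPf xQ). Qed.

Lemma extendK Q v : restrict Q (extend v) = v.
Proof.
apply/rowP => i; rewrite mxE /extend index_uniq ?fset_uniq // insubT //.
by move=> lt_i; congr (v 0 _); exact: val_inj.
Qed.

Lemma restrict_inj Q f g : (forall y, y \notin Q -> f y = g y) ->
  restrict Q f = restrict Q g -> f = g.
Proof.
move=> out fg; apply/funext => x; have [xQ|/out //] := boolP (x \in Q).
have xi : (index x Q < #|` Q|)%N by rewrite index_mem.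
have /rowP/(_ (Ordinal xi)) := fg.
by rewrite !mxE nth_index.
Qed.
End Laplacian.

(** * Folner sets and translates of finite sets *)

Section Translates.
Context {G : groupType}.
Implicit Types (A B K Q T : {fset G}) (x y t : G).

Lemma mem_mulfset A B x y : x \in A -> y \in B -> (x * y)%g \in mulfset A B.
Proof. by move=> xA yB; apply/imfset2P; exists x => //; exists y. Qed.

Lemma card_mulfset_le A B : (#|` mulfset A B| <= #|` A| * #|` B|)%N.
Proof.
rewrite -(size_allpairs (fun a b => a * b)%g A B).
apply: uniq_leq_size => // z /imfset2P[a /= aA [b /= bB ->]].
exact: (allpairs_f (fun a b => a * b)%g).
Qed.

Lemma card_invfset_le A : (#|` invfset A| <= #|` A|)%N.
Proof. exact: leq_imfset_card. Qed.

(** The inner K-boundary of [Q]. *)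
Definition leaving K Q : {fset G} :=
  [fset t in Q | ~~ all (fun k => (k * t)%g \in Q) K]%fset.

Lemma leaving_out K Q t : t \in Q -> t \notin leaving K Q ->
  forall k, k \in K -> (k * t)%g \in Q.
Proof. by move=> tQ; rewrite !inE tQ /= negbK => /allP. Qed.

(** If k * t leaves [Q], then t is k^-1 times an element of the outer boundary K Q \ Q, which is the
set that the Folner condition controls. *)
Lemma card_leaving_le K Q :
  (#|` leaving K Q| <= #|` K| * #|` (mulfset K Q `\` Q)%fset|)%N.
Proof.
apply: leq_trans (leq_mul (card_invfset_le K) (leqnn _)).
apply: leq_trans (card_mulfset_le _ _); apply: fsubset_leq_card.
apply/fsubsetP => t; rewrite !inE => /andP[tQ /allPn[k kK ktQ]].
rewrite -(mulKg k t); apply: mem_mulfset; first exact: in_imfset.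
by rewrite inE ktQ mem_mulfset.
Qed.

Lemma folner_leaving (R : realType) (Q : nat -> {fset G}) K (e : R) :
  folner R Q -> 0 < e ->
  \forall j \near \oo, #|` leaving K (Q j)|%:R <= e * #|` Q j|%:R.
Proof.
move=> [Q0 /(_ K) KQ] e0.
have e' : 0 < e / (#|` K|.+1)%:R by rewrite divr_gt0.
have /cvgr0Pnorm_le /(_ _ e') := KQ; apply: filterS => j.
have Qj : 0 < #|` Q j|%:R :> R by rewrite ltr0n cardfs_gt0.
rewrite ger0_norm; last by rewrite divr_ge0.
rewrite ler_pdivrMr // mulrAC ler_pdivlMr // => le_e.
apply: le_trans le_e; rewrite -natrM ler_nat.
by apply: leq_trans (card_leaving_le _ _) _; rewrite mulnC leq_mul.
Qed.

Definition disjoint_translates B T : Prop :=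
  forall t u b c, t \in T -> u \in T -> b \in B -> c \in B ->
    (b * t)%g = (c * u)%g -> t = u.

(** Greedy selection: once t0 is chosen, the translates B t that meet B t0 have t in B^-1 B t0, so
at most |B|^2 of them are lost. *)
Lemma exists_disjoint_translates B T b0 : b0 \in B -> exists2 T' : {fset G},
  (T' `<=` T)%fset /\ disjoint_translates B T' & (#|` T| <= #|` B| ^ 2 * #|` T'|)%N.
Proof.
move=> b0B.
have [n] := ubnP #|` T|; elim: n T => // n IH T; rewrite ltnS => Tn.
have [->|[t0 t0T]] := fset_0Vmem T.
  by exists fset0; [split => // t u b c; rewrite inE | rewrite cardfs0].
pose near := mulfset (mulfset (invfset B) B) [fset t0]%fset.
have nearP b c t : b \in B -> c \in B -> (b * t = c * t0)%g -> t \in near.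
  move=> bB cB bt; rewrite -(mulKg b t) bt mulgA; apply: mem_mulfset; last by rewrite inE.
  by apply: mem_mulfset => //; exact: in_imfset.
have t0near : t0 \in near by exact: (nearP b0 b0).
have near_card : (#|` near| <= #|` B| ^ 2)%N.
  apply: leq_trans (card_mulfset_le _ _) _; rewrite cardfs1 muln1.
  apply: leq_trans (card_mulfset_le _ _) _; rewrite -mulnn leq_mul2r.
  by rewrite card_invfset_le orbT.
have /IH[T1 [/fsubsetP T1T T1disj] T1card] : (#|` (T `\` near)%fset| < n)%N.
  apply: leq_trans Tn; rewrite (cardfsD1 t0 T) t0T ltnS fsubset_leq_card //.
  apply/fsubsetP => t; rewrite !inE => /andP[t_near ->]; rewrite andbT.
  by apply: contraNneq t_near => ->.
have t0T1 : t0 \notin T1 by apply/negP => /T1T; rewrite inE t0near.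
exists (t0 |` T1)%fset; first split.
- by rewrite fsubUset fsub1set t0T /=; apply/fsubsetP => t /T1T; rewrite inE => /andP[].
- move=> t u b c; rewrite !inE => /predU1P[->|tT1] /predU1P[->|uT1] bB cB // e.
  + by have := T1T _ uT1; rewrite inE (nearP c b).
  + by have := T1T _ tT1; rewrite inE (nearP b c).
  + exact: (T1disj t u b c).
- rewrite -(cardfsID near) cardfsU1 t0T1 mulnDr muln1 leq_add //.
  by apply: leq_trans near_card; rewrite fsubset_leq_card // fsubsetIr.
Qed.
End Translates.

(** * Eigenfunctions from patterns and from large multiplicities *)

Section Eigenfunctions.
Context {R : realType} {G : groupType}.
Implicit Types (omega : configuration G) (f : G -> R[i]) (x y t : G) (B Q : {fset G}) (la : R).

(** Edges with one endpoint in [B] and the other one anywhere are compared, so that the degrees of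
the vertices of [B] agree as well. *)
Definition looks_like omega omega0 B t : Prop :=
  forall x y, x \in B -> adj omega (x * t)%g (y * t)%g = adj omega0 x y.

Lemma looks_like_degree omega omega0 B t x : locally_finite omega ->
  locally_finite omega0 ->
  looks_like omega omega0 B t -> x \in B -> degree omega (x * t)%g = degree omega0 x.
Proof.
move=> lf lf0 same xB; rewrite /degree.
have -> : fset_set (nbrs omega (x * t)%g) = [fset y * t | y in fset_set (nbrs omega0 x)]%g%fset.
  apply/fsetP => z; rewrite in_nbrs //; apply/idP/imfsetP => [xz|[y /=]].
    exists (z * t^-1)%g; last by rewrite mulgVK.
    by rewrite /= in_nbrs // -(same _ _ xB) mulgVK.
  by rewrite in_nbrs // => xy ->; rewrite same.
by rewrite card_imfset //; exact: mulIg.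
Qed.

Definition translate f t x := f (x * t^-1)%g.

Lemma laplace_translate omega omega0 B f la t : locally_finite omega ->
  locally_finite omega0 -> looks_like omega omega0 B t ->
  (forall x, x \notin B -> f x = 0) ->
  laplace R omega0 f = (fun x => la%:C%C * f x) ->
  laplace R omega (translate f t) = (fun x => la%:C%C * translate f t x).
Proof.
move=> lf lf0 same fB eigen; apply/funext => z.
pose Bt := [fset x * t | x in B]%g%fset.
have ftB y : y \notin Bt -> translate f t y = 0.
  move=> yBt; apply: fB; apply: contra yBt => yB; apply/imfsetP.
  by exists (y * t^-1)%g => //; rewrite mulgVK.
rewrite (laplace_supported (lf _) ftB).
rewrite /translate -[RHS](congr1 (@^~ (z * t^-1)%g) eigen).
rewrite (laplace_supported (lf0 _) fB); congr (_ - _).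
  have [zB|zB] := boolP (z * t^-1 \in B)%g; last by rewrite fB ?mulr0.
  by rewrite -(looks_like_degree lf lf0 same zB) mulgVK.
rewrite [LHS]big_mkcond big_imfset /=; last by move=> x y _ _; exact: mulIg.
rewrite [RHS]big_mkcond; apply: eq_big_seq => y yB.
by rewrite mulgK adjC -[z in LHS](mulgVK t) same // adjC.
Qed.

(** Translates of [f] by the elements of a subset of [T] for which the translates of [B] are
disjoint are linearly independent eigenvectors. *)
Lemma multiplicity_ge omega omega0 B Q f la (T : {fset G}) : locally_finite omega ->
  locally_finite omega0 ->
  (forall x, x \notin B -> f x = 0) -> f <> (fun=> 0) ->
  laplace R omega0 f = (fun x => la%:C%C * f x) ->
  (forall t, t \in T -> looks_like omega omega0 B t) ->
  (forall t b, t \in T -> b \in B -> (b * t)%g \in Q) ->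
  (#|` T| <= #|` B| ^ 2 * multiplicity (laplacian_mx R omega Q) la)%N.
Proof.
move=> lf lf0 fB f0 eigen same BTQ.
have [b0 fb0] : exists b, f b != 0.
  apply: contrapT => none; apply: f0; apply/funext => x.
  by apply/eqP; apply: contrapT => /negP fx; apply: none; exists x.
have b0B : b0 \in B by apply: contraNT fb0 => /fB ->.
have [T' [/fsubsetP T'T disj] Tcard] := exists_disjoint_translates T b0B.
apply: leq_trans Tcard _; rewrite leq_mul2l; apply/orP; right.
pose t (i : 'I_#|` T'|) := nth 1%g T' i.
have tT' i : t i \in T' by exact: mem_nth.
have tT i : t i \in T by exact: T'T.
have t_inj : injective t.
  by move=> i j /eqP; rewrite nth_uniq ?fset_uniq // => /eqP /val_inj.
have b0Q i : (index (b0 * t i)%g Q < #|` Q|)%N.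
  by rewrite index_mem BTQ.
(* The translate of b0 by t i lies in the support of the i-th translate of f only. *)
pose c i := Ordinal (b0Q i).
pose V := \matrix_(k < #|` T'|) restrict Q (translate f (t k)).
have Vc i k : V k (c i) = f (b0 * t i * (t k)^-1)%g.
  by rewrite !mxE nth_index // BTQ.
rewrite -(@rank_disjoint_supports _ _ _ V c).
- apply: mxrankS; apply/eigenspaceP; apply/row_matrixP => i.
  rewrite row_mul linearZ /= rowK restrict_mul_laplacian //; last first.
    move=> y yQ; apply: fB; apply: contra yQ => yB.
    by rewrite -(mulgVK (t i) y) BTQ.
  rewrite (laplace_translate lf lf0 (same _ (T'T _ (tT' i))) fB eigen).
  by apply/rowP => j; rewrite !mxE.
- by move=> i; rewrite Vc mulgK.
- move=> i k ik; rewrite Vc; apply: fB; apply: contra ik => b1B.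
  apply/eqP/t_inj; apply: (disj _ _ _ _ (tT' i) (tT' k) b0B b1B).
  by rewrite mulgVK.
Qed.

Definition boundary omega Q : set G :=
  [set y | exists2 x, x \notin Q & adj omega y x].

(** Off [Q], the Laplacian of a function supported in [Q] only sees the values at the boundary of
[Q]; so an eigenvector of the matrix that vanishes there extends by zero to an eigenfunction. *)
Lemma eigenfunction_vanishing omega Q (Z : {fset G}) la : locally_finite omega ->
  (forall y, y \in Q -> boundary omega Q y -> y \in Z) ->
  (#|` Z| < multiplicity (laplacian_mx R omega Q) la)%N ->
  exists f, [/\ f <> (fun=> 0), (forall x, x \notin Q -> f x = 0),
    (forall x, x \in Z -> f x = 0) & laplace R omega f = (fun x => la%:C%C * f x)].
Proof.
move=> lf bdZ Zlt; pose Z' := finset (fun i : 'I_#|` Q| => nth 1%g Q i \in Z).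
have Z'card : (#|Z'| <= #|` Z|)%N.
  rewrite cardE -(size_map (fun i : 'I_#|` Q| => nth 1%g Q i)); apply: uniq_leq_size.
    rewrite map_inj_uniq ?enum_uniq // => i j /eqP.
    by rewrite nth_uniq ?fset_uniq // => /eqP /val_inj.
  by apply/allP; rewrite all_map; apply/allP => i; rewrite mem_enum inE.
have [v [v0 vA vZ]] := eigenvector_vanishing (leq_ltn_trans Z'card Zlt).
pose f := extend v.
have fQ x : x \notin Q -> f x = 0 by exact: extend_out.
have fZ x : x \in Z -> f x = 0.
  move=> xZ; have [xQ|/fQ //] := boolP (x \in Q).
  have xi : (index x Q < #|` Q|)%N by rewrite index_mem.
  have := vZ (Ordinal xi); rewrite inE /= nth_index // => /(_ xZ) <-.
  by rewrite /f /extend insubT.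
exists f; split => //.
  move=> f0; case/eqP: v0; rewrite -(extendK v) -/f f0.
  by apply/rowP => i; rewrite !mxE.
apply: (@restrict_inj _ _ Q); last first.
  rewrite -restrict_mul_laplacian // extendK vA -{1}(extendK v).
  by apply/rowP => i; rewrite !mxE.
move=> y yQ; rewrite (laplace_supported (lf _) fQ) fQ // !mulr0 sub0r.
rewrite big_seq_cond big1 ?oppr0 // => x /andP[xQ yx].
by apply: fZ; apply: bdZ => //; exists y; rewrite // adjC.
Qed.

End Eigenfunctions.

Section IndependentSequence.
Context {R : realType} {G : groupType}.

(** Each function is chosen to vanish on the supports of all previous ones, so the supports are
pairwise disjoint. *)
Lemma independent_sequence (P : (G -> R[i]) -> Prop) :
  (forall f, P f -> finitely_supported f /\ f <> (fun=> 0)) ->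
  (forall W : {fset G}, exists f, P f /\ forall x, x \in W -> f x = 0) ->
  exists f : nat -> G -> R[i], (forall k, P (f k)) /\ linearly_independent f.
Proof.
move=> Pfin /choice[g gP].
pose supp f : {fset G} := fset_set [set x | f x != 0 :> R[i]].
pose W k : {fset G} := iter k (fun W => W `|` supp (g W))%fset fset0.
have WS k : W k.+1 = (W k `|` supp (g (W k)))%fset by [].
clearbody W.
have W_mono i k : (i <= k)%N -> {subset W i <= W k}.
  move=> /subnK <-; elim: (k - i)%N => // n IH x /IH.
  by rewrite addSn WS inE => ->.
have zero_lt i k x : (i < k)%N -> g (W i) x != 0 -> g (W k) x = 0.
  move=> ik gx; apply: (gP (W k)).2; apply: (W_mono _ _ ik).
  have [fin _] := Pfin _ (gP (W i)).1.
  rewrite WS inE; apply/orP; right.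
  by rewrite in_fset_set //; exact/mem_set.
exists (fun k => g (W k)); split=> [k|n c sum0 i]; first exact: (gP _).1.
have [x gx] : exists x, g (W i) x != 0.
  have [_ g0] := Pfin _ (gP (W i)).1; apply: contrapT => none; apply: g0.
  by apply/funext => x; apply/eqP; apply: contrapT => /negP gx; apply: none; exists x.
have := sum0 x; rewrite (bigD1 i) //= big1 ?addr0 => [/eqP|k ki].
  by rewrite mulf_eq0 (negPf gx) orbF => /eqP.
have [ki_lt|ik_lt|ki_eq] := ltngtP k i.
- have [->|gkx] := eqVneq (g (W k) x) 0; first by rewrite mulr0.
  by move: gx; rewrite (zero_lt k i x) ?eqxx.
- by rewrite (zero_lt i k x) ?mulr0.
- by rewrite (val_inj ki_eq) eqxx in ki.
Qed.
End IndependentSequence.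

(** * First moment estimates *)

Section ProbabilityLemmas.
Context {d : measure_display} {T : measurableType d} {R : realType} (P : probability T R).

(** The number of [y] in [Y] whose event occurs, as a sum of indicators so that it is visibly a
random variable; [count_eventE] identifies it with a cardinal. *)
Definition count_event (I : choiceType) (Y : {fset I}) (D : I -> set T) (w : T) : R :=
  \sum_(y <- Y) \1_(D y) w.

Lemma count_eventE (I : choiceType) (Y : {fset I}) (D : I -> set T) (w : T) :
  count_event Y D w = #|` [fset y in Y | w \in D y]%fset|%:R.
Proof.
have -> : #|` [fset y in Y | w \in D y]%fset| = count (fun y => w \in D y) Y.
  rewrite -size_filter; apply: perm_size; apply: uniq_perm => [||y].
  - exact: fset_uniq.
  - exact/filter_uniq/fset_uniq.
  - by rewrite mem_filter !inE andbC.
rewrite /count_event -sum1_count natr_sum [RHS]big_mkcond /=.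
by apply: eq_bigr => y _; rewrite indicE; case: (_ \in _).
Qed.

Lemma measurable_count_event (I : choiceType) (Y : {fset I}) (D : I -> set T) :
  (forall y, measurable (D y)) -> measurable_fun setT (count_event Y D).
Proof.
move=> mD; apply: measurable_sum => y.
exact: measurable_indic.
Qed.

Lemma measurable_count_ge (I : choiceType) (Y : {fset I}) (D : I -> set T) (c : R) :
  (forall y, measurable (D y)) -> measurable [set w | c <= count_event Y D w].
Proof.
move=> mD; have mle := measurable_fun_ler (measurable_cst c) (measurable_count_event Y mD).
by have := mle measurableT [set true] Logic.I; rewrite setTI preimage_true.
Qed.

(** The Markov inequality for the counting variable, whose expectation is at most q |Y|. *)
Lemma markov_count (I : choiceType) (Y : {fset I}) (D : I -> set T) (q e : R) :
  Y != fset0 -> 0 < e -> (forall y, measurable (D y)) -> (forall y, (P (D y) <= q%:E)%E) ->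
  (P [set w | (e * #|` Y|%:R <= count_event Y D w)%R] <= (q / e)%:E)%E.
Proof.
move=> Y0 e0 mD PD; set c := e * _; set C := [set w | _].
have c0 : 0 < c by rewrite mulr_gt0 // ltr0n cardfs_gt0.
have mC : measurable C by exact: measurable_count_ge.
have : (c%:E * P C <= \sum_(y <- Y) P (D y))%E.
  have -> : (c%:E * P C = \int[P]_w (c%:E * (\1_C w)%:E))%E.
    rewrite ge0_integralZl //; first by rewrite integral_indic // setIT.
    - by apply/measurable_EFinP; exact: measurable_indic.
    - by rewrite lee_fin ltW.
  have -> : (\sum_(y <- Y) P (D y) = \int[P]_w \sum_(y <- Y) (\1_(D y) w)%:E)%E.
    rewrite ge0_integral_sum //.
    - by apply: eq_bigr => y _; rewrite integral_indic // setIT.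
    - by move=> y; apply/measurable_EFinP; exact: measurable_indic.
  apply: ge0_le_integral => //.
  - by move=> w _; rewrite -EFinM lee_fin mulr_ge0 // ltW.
  - by apply: measurable_funeM; apply/measurable_EFinP; exact: measurable_indic.
  - by apply: emeasurable_sum => y; apply/measurable_EFinP; exact: measurable_indic.
  - move=> w _; rewrite sumEFin -EFinM lee_fin indicE.
    have [wC|wC] := boolP (w \in C); last by rewrite mulr0 sumr_ge0.
    by rewrite mulr1; move: wC; rewrite inE.
move=> H; have {H} : (c%:E * P C <= (#|` Y|%:R * q)%:E)%E.
  apply: le_trans H _; apply: (@le_trans _ _ (\sum_(y <- Y) q%:E)%E).
    by apply: lee_sum => y _.
  by rewrite sumEFin big_const_seq count_predT iter_addr addr0 mulr_natl.
rewrite -(@fineK _ (P C)) ?fin_num_measure // -EFinM !lee_fin.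
have Y1 : 0 < #|` Y|%:R :> R by rewrite ltr0n cardfs_gt0.
by rewrite ler_pdivlMr // /c mulrAC [leRHS]mulrC ler_pM2r // mulrC.
Qed.

Definition eventually_event (C : nat -> set T) : set T :=
  \bigcup_J \bigcap_(j in [set j | (J <= j)%N]) C j.

Lemma measurable_eventually (C : nat -> set T) :
  (forall j, measurable (C j)) -> measurable (eventually_event C).
Proof.
by move=> mC; apply: bigcup_measurable => J _; apply: bigcap_measurable => //; exists J => /=.
Qed.

(** The intersections over j >= J increase with J and each lies in some C j with j large. If q < 1,
it follows that with positive probability C j fails for infinitely many j. *)
Lemma measure_eventually_le (C : nat -> set T) (q : R) :
  (forall j, measurable (C j)) -> (\forall j \near \oo, (P (C j) <= q%:E)%E) ->
  (P (eventually_event C) <= q%:E)%E.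
Proof.
move=> mC [J0 _ PC].
have mcap J : measurable (\bigcap_(j in [set j | (J <= j)%N]) C j).
  by apply: bigcap_measurable => //; exists J => /=.
have mcup := measurable_eventually mC.
have mono : {homo (fun J : nat => \bigcap_(j in [set j | (J <= j)%N]) C j) : n m /
    (n <= m)%N >-> (n <= m)%O}.
  move=> n m nm; apply/subsetPset => w + j /= mj; apply => /=.
  exact: leq_trans mj.
have cvgP := nondecreasing_cvg_mu (mu := P) mcap mcup mono.
rewrite /eventually_event -(cvg_lim _ cvgP) //; apply: lime_le.
  by apply/cvg_ex; eexists; exact: cvgP.
near=> J; apply: (@le_trans _ _ (P (C (maxn J J0)))).
  by apply: le_measure; rewrite ?inE // => w; apply; rewrite /= leq_maxl.
by apply: PC; rewrite /= leq_maxr.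
Unshelve. all: by end_near. Qed.

End ProbabilityLemmas.

(** * Countability and almost sure statements *)

Section Countability.
Context {G : groupType}.

Lemma generated_countable (S : {fset G}) :
  symmetric_generating_set S -> countable [set: G].
Proof.
move=> [_ gen].
have : [set: G] `<=` range (fun l : seq nat => (\prod_(i <- l) nth 1 S i)%g).
  move=> x _; have [s [/allP sS ->]] := gen x; exists [seq index y S | y <- s] => //.
  by rewrite big_map; apply: eq_big_seq => y /sS yS; rewrite nth_index.
move=> /subset_card_le /sub_countable; apply.
apply: sub_countable; last exact: (@countableP _ [set: seq nat]).
exact: card_image_le.
Qed.

Lemma countable_fsets (T : choiceType) : countable [set: T] -> countable [set: {fset T}].
Proof.
move=> /countable_injP[f f_inj].
have f_injT : injective f by move=> x y; apply: f_inj; rewrite inE.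
apply/countable_injP; exists (fun A : {fset T} => CodeSeq.code (map f (enum_fset A))).
move=> A B _ _ /(can_inj CodeSeq.codeK) AB; apply/fsetP => x.
by rewrite -(mem_map f_injT) AB mem_map.
Qed.

Lemma countable_edges : countable [set: G] -> countable [set: edge G].
Proof.
move=> /countable_fsets/countable_injP[f f_inj].
apply/countable_injP; exists (f \o val) => e e' _ _ /= ee'.
by apply/val_inj/f_inj; rewrite ?inE.
Qed.

Lemma increasing_card (Q : nat -> {fset G}) j : strictly_increasing Q -> (j <= #|` Q j|)%N.
Proof. by move=> Qinc; elim: j => // j /leq_ltn_trans; apply. Qed.

Lemma increasing_infinite (Q : nat -> {fset G}) :
  strictly_increasing Q -> infinite_set [set: G].
Proof.
move=> Qinc /finite_fsetP[A AE].
have := increasing_card #|` A|.+1 Qinc; rewrite ltnNge fsubset_leq_card //.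
by apply/fsubsetP => x _; have : [set: G] x by []; rewrite AE.
Qed.

Lemma exists_enumeration : countable [set: G] -> infinite_set [set: G] ->
  exists e : nat -> G, bijective e.
Proof.
move=> cG iG; have /card_set_bijP[f] := eq_card_nat cG iG.
by rewrite setTT_bijective => -[e fK eK]; exists e; exists f.
Qed.
End Countability.

Section AlmostEverywhere.
Context {d : measure_display} {T : measurableType d} {R : realType} (P : probability T R).

Lemma ae_forall_countable (I : Type) (A : I -> T -> Prop) : countable [set: I] ->
  (forall i, {ae P, forall w, A i w}) -> {ae P, forall w, forall i, A i w}.
Proof.
move=> /countable_injP[f f_inj] aeA.
have : {ae P, forall w, forall n i, f i = n -> A i w}.
  apply: ae_foralln => n.
  have [[i0 fi0]|none] := pselect (exists i, f i = n).
    apply: filterS (aeA i0) => w Aw i fi.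
    by have -> : i = i0 by apply: f_inj; rewrite ?inE // fi.
  by apply: aeW => w i fi; case: none; exists i.
by apply: filterS => w H i; exact: (H (f i)).
Qed.

Lemma ae_and (A B : T -> Prop) : {ae P, forall w, A w} -> {ae P, forall w, B w} ->
  {ae P, forall w, A w /\ B w}.
Proof. by move=> aeA aeB; apply: filterS2 aeA aeB => w. Qed.

Lemma ae_notin (A : set T) : measurable A -> (forall q : R, 0 < q -> (P A <= q%:E)%E) ->
  {ae P, forall w, ~ A w}.
Proof.
move=> mA PA; exists A; split => //; last by move=> w /= /contrapT.
apply/eqP; rewrite eq_le measure_ge0 andbT; apply/lee_addgt0Pr => q q0.
by rewrite add0e; exact: PA.
Qed.
End AlmostEverywhere.

(** * Edges, patterns and long edges in percolation *)

Section Edges.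
Context {R : realType} {G : groupType}.
Implicit Types (x y t : G) (a : edge G) (omega : configuration G) (B : {fset G}).

Lemma edge_of_neq x y : x != y -> {a : edge G | val a = [fset x; y]%fset}.
Proof.
move=> xy; have card2 : #|` [fset x; y]%fset| == 2 by rewrite cardfs2 xy.
by exists (Sub [fset x; y]%fset card2); rewrite SubK.
Qed.

Lemma edge_endpoints a : exists x y, x != y /\ val a = [fset x; y]%fset.
Proof.
have mem z : (z \in val a) = (z \in enum_fset (val a)) by [].
have := valP a; have := fset_uniq (val a).
case: (enum_fset _) mem => [|x [|y []]] //= mem /andP[]; rewrite inE => xy _ _.
by exists x, y; split => //; apply/fsetP => z; rewrite mem !inE.
Qed.

Lemma adj_edge omega x y a : val a = [fset x; y]%fset -> adj omega x y = omega a.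
Proof. by move=> e; rewrite /adj -e valK. Qed.

(** The two enumerations of the endpoints give the values of p at x y^-1 and at its inverse, which
agree by symmetry. *)
Lemma edge_probE (p : G -> R) x y a : (forall x, p x = p x^-1%g) ->
  val a = [fset x; y]%fset -> edge_prob p a = p (x * y^-1)%g.
Proof.
move=> p_sym e; rewrite /edge_prob.
have s2 : size (enum_fset (val a)) = 2 by exact/eqP/(valP a).
have inxy i : (i < 2)%N -> nth 1%g (val a) i \in [fset x; y]%fset.
  by move=> i2; rewrite -e mem_nth // s2.
have : nth 1%g (val a) 0 != nth 1%g (val a) 1 by rewrite nth_uniq ?s2 ?fset_uniq.
have := inxy 0%N isT; have := inxy 1%N isT; rewrite !in_fset2.
move=> /orP[]/eqP -> /orP[]/eqP ->; rewrite ?eqxx // => _.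
by rewrite p_sym invgM invgK.
Qed.

Fact shift_subproof t a : #|` [fset x * t | x in val a]%g%fset| == 2.
Proof. by rewrite card_imfset ?(valP a) //; exact: mulIg. Qed.

Definition shift t a : edge G := Sub [fset x * t | x in val a]%g%fset (shift_subproof t a).

Lemma val_shift t a x y : val a = [fset x; y]%fset ->
  val (shift t a) = [fset x * t; y * t]%g%fset.
Proof. by move=> e; rewrite SubK e imfset_fset2. Qed.

Lemma shiftK t : cancel (shift t) (shift t^-1%g).
Proof.
move=> a; have [x [y [_ e]]] := edge_endpoints a.
by apply: val_inj; rewrite (val_shift _ (val_shift t e)) !mulgK.
Qed.

Lemma shift1 a : shift 1%g a = a.
Proof.
have [x [y [_ e]]] := edge_endpoints a.
by apply: val_inj; rewrite (val_shift _ e) !mulg1.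
Qed.

Definition touches B a := has (mem (val a)) B.

(** The translate by [t] of the event that, among the edges touching [B], the open ones are those in
[U]. Encoding a pattern by finite sets leaves only countably many of them. *)
Definition pattern B (U : {fset edge G}) t : set (Omega G) :=
  [set omega | forall a, touches B a -> omega (shift t a) = (a \in U)].

Lemma pattern_looks_like B U t (omega omega0 : configuration G) :
  pattern B U t omega -> pattern B U 1%g omega0 -> looks_like omega omega0 B t.
Proof.
move=> pat pat0 x y xB; have [->|xy] := eqVneq x y; first by rewrite !adjxx.
have [a ae] := edge_of_neq xy.
have tB : touches B a by apply/hasP; exists x => //=; rewrite ae !inE eqxx.
rewrite (adj_edge _ (val_shift t ae)) (adj_edge _ ae) pat // -pat0 //.
by rewrite shift1.
Qed.

Lemma pattern_exists B (omega : configuration G) : locally_finite omega ->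
  exists U, pattern B U 1%g omega.
Proof.
move=> lf; pose V := [set a | touches B a /\ omega a].
have finV : finite_set V.
  have : finite_set (\bigcup_(x in [set` B]) [set [fset x; y]%fset | y in nbrs omega x]).
    by apply: bigcup_finite => // x _; exact: finite_image.
  move=> fin; apply: sub_finite_set (finite_preimage (f := val) _ fin); last first.
    by move=> a b _ _; exact: val_inj.
  move=> a [/hasP[x xB /= xa] oa]; exists x => //.
  have [u [v [_ ae]]] := edge_endpoints a; move: xa; rewrite ae !inE.
  move=> /orP[]/eqP xE; subst x.
    by exists v => //; rewrite /nbrs /= (adj_edge _ ae).
  by exists u; [rewrite /nbrs /= adjC (adj_edge _ ae) | rewrite fsetUC].
exists (fset_set V) => a tB; rewrite shift1 in_fset_set //.
by apply/idP/idP => [oa|]; rewrite inE => // -[].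
Qed.
End Edges.

Section Percolation.
Context {R : realType} {G : groupType} (p : G -> R) (Pr : probability (Omega G) R).
Hypothesis p_sym : forall x, p x = p (x^-1)%g.
Hypothesis p_ge0 : forall x, 0 <= p x.
Hypothesis PrP : product_measure p Pr.

Lemma measurable_cylinder (F : {fset edge G}) eta : measurable (cylinder F eta : set (Omega G)).
Proof. by apply: sub_sigma_algebra; exists F, eta. Qed.

Lemma adj_cylinder x y (a : edge G) : val a = [fset x; y]%fset ->
  [set omega | adj omega x y] = cylinder [fset a]%fset (fun=> true).
Proof.
move=> ae; apply/seteqP; split => omega /=; rewrite (adj_edge _ ae).
  by move=> oa b; rewrite inE => /eqP ->.
by apply; rewrite inE.
Qed.

Lemma measurable_adj x y : measurable ([set omega | adj omega x y] : set (Omega G)).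
Proof.
have [<-|xy] := eqVneq x y.
  rewrite (_ : [set _ | _] = set0) //; apply/seteqP; split => // omega /=.
  by rewrite adjxx.
have [a ae] := edge_of_neq xy.
by rewrite (adj_cylinder ae); exact: measurable_cylinder.
Qed.

Lemma Pr_adj_le x y : (Pr [set omega | adj omega x y] <= (p (x * y^-1)%g)%:E)%E.
Proof.
have [<-|xy] := eqVneq x y.
  rewrite (_ : [set _ | _] = set0) ?measure0 ?lee_fin //; apply/seteqP; split => // omega /=.
  by rewrite adjxx.
have [a ae] := edge_of_neq xy.
by rewrite (adj_cylinder ae) PrP big_seq_fset1 (edge_probE p_sym ae).
Qed.

Section Patterns.
Hypothesis countG : countable [set: G].

(** A pattern constrains infinitely many edges, so it is a decreasing intersection of cylinders; the
sets [F n] do not depend on [t], which makes the translates comparable. *)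
Lemma pattern_cylinders B (U : {fset edge G}) : exists F : nat -> {fset edge G},
  {homo F : m n / (m <= n)%N >-> (m `<=` n)%fset} /\
  forall t, pattern B U t = \bigcap_n
    cylinder [fset shift t a | a in F n]%fset (fun b => shift t^-1%g b \in U).
Proof.
have /countable_injP[f f_inj] := countable_edges countG.
pose F n := fset_set [set a | touches B a /\ (f a < n)%N].
have inF n a : (a \in F n) = touches B a && (f a < n)%N.
  rewrite in_fset_set; first by apply/idP/andP; rewrite inE.
  apply: (@sub_finite_set _ _ (f @^-1` `I_n)); first by move=> b [].
  by apply: finite_preimage => // b c _ _; apply: f_inj; rewrite inE.
exists F; split=> [m n mn|t].
  by apply/fsubsetP => a; rewrite !inF => /andP[-> /leq_trans]; apply.
apply/seteqP; split=> omega.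
  by move=> pat n _ b /imfsetP[a /=]; rewrite inF => /andP[tB _] ->; rewrite shiftK pat.
move=> cyl a tB; rewrite (cyl (f a).+1) ?shiftK //.
by apply: in_imfset; rewrite /= inF tB ltnSn.
Qed.

Lemma measurable_pattern B U t : measurable (@pattern G B U t).
Proof.
have [F [_ ->]] := pattern_cylinders B U.
by apply: bigcapT_measurable => n; exact: measurable_cylinder.
Qed.

Lemma Pr_cylinder_shift (F U : {fset edge G}) t :
  Pr (cylinder [fset shift t a | a in F]%fset (fun b => shift t^-1%g b \in U)) =
  (\prod_(a <- F) (if a \in U then edge_prob p a else 1 - edge_prob p a))%:E.
Proof.
rewrite PrP big_imfset /=; last by move=> a b _ _; exact: can_inj (shiftK t) _ _.
congr EFin; apply: eq_bigr => a _; rewrite shiftK.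
have [x [y [_ e]]] := edge_endpoints a.
by rewrite (edge_probE p_sym e) (edge_probE p_sym (val_shift t e)) invgM mulgA mulgK.
Qed.

(** The edge probabilities depend on x y^-1 only, which right translation preserves; so the
approximating cylinders have equal probabilities, and limits are unique. *)
Lemma Pr_pattern_shift B U t : Pr (pattern B U t) = Pr (pattern B U 1%g).
Proof.
have [F [F_mono patE]] := pattern_cylinders B U.
have lim s : (\prod_(a <- F n) (if a \in U then edge_prob p a else 1 - edge_prob p a))%:E
    @[n --> \oo] --> Pr (pattern B U s).
  have := measurable_pattern B U s; rewrite patE => mcap.
  under eq_fun do rewrite -(Pr_cylinder_shift _ _ s).
  apply: nonincreasing_cvg_mu => //.
  - by rewrite (le_lt_trans (probability_le1 _ _)) ?ltry //; exact: measurable_cylinder.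
  - by move=> n; exact: measurable_cylinder.
  - move=> m n mn; apply/subsetPset => omega cyl b /imfsetP[a /= aF ->].
    by apply: cyl; apply: in_imfset => /=; exact: (fsubsetP (F_mono _ _ mn)).
by apply: cvg_unique (lim t) (lim 1%g).
Qed.

Lemma ae_pattern : {ae Pr, forall omega, forall B U,
  Pr (pattern B U 1%g) = 0%E -> ~ pattern B U 1%g omega}.
Proof.
have aeBU B U : {ae Pr, forall omega, Pr (pattern B U 1%g) = 0%E -> ~ pattern B U 1%g omega}.
  have [P0|P0] := pselect (Pr (pattern B U 1%g) = 0%E); last by apply: aeW.
  have : {ae Pr, forall omega, ~ pattern B U 1%g omega}.
    by apply: ae_notin => [|q q0]; [exact: measurable_pattern | rewrite P0 lee_fin ltW].
  by apply: filterS.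
apply: ae_forall_countable; first exact: countable_fsets.
move=> B; apply: ae_forall_countable; first exact/countable_fsets/countable_edges.
exact: aeBU.
Qed.
End Patterns.

Section LongEdges.
Context (e : nat -> G).
Hypothesis e_bij : bijective e.
Hypothesis p_l1 : esum.summable [set: G] (EFin \o p).

(** The length of an edge at [y] is measured by the rank of x y^-1 in the enumeration [e]. *)
Definition long_edge M y : set (Omega G) :=
  \bigcup_(n in ~` `I_M) [set omega | adj omega (e n * y)%g y].

Lemma measurable_long_edge M y : measurable (long_edge M y).
Proof. by apply: bigcup_measurable => n _; exact: measurable_adj. Qed.

(** By the union bound the probability is at most a tail of the summable series of the p (e n),
uniformly in [y]. *)
Lemma Pr_long_edge_small (q : R) : 0 < q -> exists M, forall y, (Pr (long_edge M y) <= q%:E)%E.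
Proof.
move=> q0.
have sum_fin : (\sum_(0 <= n <oo) (p (e n))%:E < +oo)%E.
  rewrite nneseries_esum; last by move=> n _; rewrite lee_fin.
  rewrite set_true -(reindex_esum setT setT e (fun x => (p x)%:E)); last first.
    by rewrite setTT_bijective.
  move: p_l1; rewrite /esum.summable; under eq_esum do rewrite /= ger0_norm //.
  by [].
have /fine_cvgP[[M1 _ fin] /cvgr0Pnorm_lt /(_ _ q0)[M2 _ small]] :=
  nneseries_tail_cvg sum_fin (fun n _ => p_ge0 (e n)).
exists (maxn M1 M2) => y; set M := maxn _ _.
apply: (@le_trans _ _ (\sum_(M <= n <oo) (p (e n))%:E)%E).
  apply: (@le_trans _ _ (\sum_(M <= n <oo) Pr [set omega | adj omega (e n * y)%g y])%E).
    apply: measure_sigma_subadditive_tail => // [n|]; first exact: measurable_adj.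
    exact: measurable_long_edge.
  apply: lee_nneseries => n _; first by rewrite measure_ge0.
  by rewrite (le_trans (Pr_adj_le _ _)) // mulgK.
rewrite -(fineK (fin M _)) ?lee_fin /=; last by rewrite /M leq_maxl.
by apply: le_trans (ler_norm _) _; rewrite ltW // small //= /M leq_maxr.
Qed.

(** A vertex of infinite degree has arbitrarily long edges, an event of arbitrarily small
probability. *)
Lemma ae_locally_finite : countable [set: G] -> {ae Pr, forall omega, locally_finite omega}.
Proof.
move=> countG; apply: ae_forall_countable => // y.
have : {ae Pr, forall omega, ~ (\bigcap_M long_edge M y) omega}.
  apply: ae_notin => [|q q0].
    by apply: bigcapT_measurable => M; exact: measurable_long_edge.
  have [M PrM] := Pr_long_edge_small q0; apply: le_trans (PrM y).
  apply: le_measure; rewrite ?inE; last exact: bigcap_inf.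
    by apply: bigcapT_measurable => k; exact: measurable_long_edge.
  exact: measurable_long_edge.
apply: filterS => omega /existsNP[M /not_implyP[_ farM]].
apply: (@sub_finite_set _ _ [set (e n * y)%g | n in `I_M]); last exact: finite_image.
move=> x yx; have [e' _ eK] := e_bij.
exists (e' (x * y^-1)%g); last by rewrite eK mulgVK.
apply: contrapT => far; apply: farM; exists (e' (x * y^-1)%g) => //.
by rewrite /= eK mulgVK adjC.
Qed.

(** For fixed [M], the Markov inequality bounds the probability that the proportion is eventually at
least 1 / (k + 1) by k + 1 times that of having a long edge; this tends to 0 as [M] grows. *)
Lemma ae_few_long_edges (Q : nat -> {fset G}) : (forall j, Q j != fset0) ->
  {ae Pr, forall omega, forall k : nat, exists M, forall J, exists2 j, (J <= j)%N &
    count_event (R := R) (Q j) (long_edge M) omega < k.+1%:R^-1 * #|` Q j|%:R}.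
Proof.
move=> Q0; apply: ae_foralln => k.
pose C M j : set (Omega G) :=
  [set omega | k.+1%:R^-1 * #|` Q j|%:R <= count_event (R := R) (Q j) (long_edge M) omega].
have mC M j : measurable (C M j) by apply: measurable_count_ge => y; exact: measurable_long_edge.
pose Z M : set (Omega G) := eventually_event (C M).
have mZ M : measurable (Z M) by exact: measurable_eventually.
have : {ae Pr, forall omega, ~ (\bigcap_M Z M) omega}.
  apply: ae_notin => [|q q0]; first exact: bigcapT_measurable.
  have [M PrM] : exists M, forall y, (Pr (long_edge M y) <= (q / k.+1%:R)%:E)%E.
    by apply: Pr_long_edge_small; rewrite divr_gt0.
  apply: (@le_trans _ _ (Pr (Z M))).
    by apply: le_measure; rewrite ?inE //; [exact: bigcapT_measurable | exact: bigcap_inf].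
  apply: measure_eventually_le => //; apply: nearW => j.
  have k0 : 0 < k.+1%:R^-1 :> R by rewrite invr_gt0.
  have := markov_count (Q0 j) k0 (measurable_long_edge M) PrM.
  by rewrite invrK divfK.
apply: filterS => omega /existsNP[M /not_implyP[_ ZM]]; exists M => J.
have /existsNP[j /not_implyP[/= Jj Cj]] : ~ (\bigcap_(j in [set j | (J <= j)%N]) C M j) omega.
  by move=> H; apply: ZM; exists J.
by exists j => //; rewrite ltNge; apply/negP.
Qed.

End LongEdges.
End Percolation.

(** * Discontinuities and eigenfunctions *)

Section SpectralEquivalence.
Context {R : realType} {G : groupType} (Q : nat -> {fset G}) (N : R -> R).
Hypothesis Q_folner : folner R Q.
Hypothesis Q_inc : strictly_increasing Q.

Definition ids_limit (omega : configuration G) : Prop :=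
  {uniform, (fun j E => eigenvalue_count (laplacian_mx R omega (Q j)) E
                        / #|` Q j|%:R : R) @ \oo --> N}.

Definition eigenfunction (omega : configuration G) (la : R) (f : G -> R[i]) : Prop :=
  [/\ finitely_supported f, f <> (fun=> 0) & laplace R omega f = (fun x => la%:C%C * f x)].

Lemma Q_card_gt0 j : (0 < #|` Q j|)%N.
Proof. by rewrite cardfs_gt0; have [] := Q_folner. Qed.

(** With m_j >= c |Q_j|, each of the three kinds of forbidden vertices (the prescribed set [W],
those moved out of Q_j by a short edge, those with a long edge) takes up at most c / 4 of Q_j, for
suitable arbitrarily large j. *)
Lemma discontinuous_eigenfunctions (e : nat -> G) (omega : configuration G) la :
  bijective e -> locally_finite omega -> ids_limit omega ->
  (forall k : nat, exists M, forall J, exists2 j, (J <= j)%N &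
    count_event (R := R) (Q j) (long_edge e M) omega < k.+1%:R^-1 * #|` Q j|%:R) ->
  ~ {for la, continuous N} ->
  exists f : nat -> G -> R[i], (forall k, eigenfunction omega la (f k)) /\ linearly_independent f.
Proof.
move=> [e' _ eK] lf idsN few disc; apply: independent_sequence => [f []//|W].
have [c c0 [J1 _ mult_ge]] := discontinuous_multiplicity Q_card_gt0 idsN disc.
have c4 : 0 < c / 4 by rewrite divr_gt0.
have [k k_small] : exists k : nat, k.+1%:R^-1 < c / 4.
  have /cvgr0_norm_lt /(_ _ c4)[k _ H] := @cvg_harmonic R.
  by exists k; have := H k (leqnn k); rewrite /harmonic /= ger0_norm.
have [M fewM] := few k.
pose K := [fset e n | n in iota 0 M]%fset.
have [J2 _ leave] := folner_leaving K Q_folner c4.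
have [J3 J3W] : exists J3 : nat, #|` W|%:R < c / 4 * J3%:R.
  exists (Num.truncn (#|` W|%:R / (c / 4))).+1.
  by rewrite mulrC -ltr_pdivrMr //; exact: truncnS_gt.
have [j /=] := fewM (maxn J1 (maxn J2 J3)).
rewrite !geq_max => /and3P[J1j J2j J3j] long_lt.
pose far := [fset y in Q j | omega \in long_edge e M y]%fset.
pose Z := (W `|` leaving K (Q j) `|` far)%fset.
have Zlt : (#|` Z| < multiplicity (laplacian_mx R omega (Q j)) la)%N.
  rewrite -(ltr_nat R); apply: lt_le_trans (mult_ge j J1j).
  have Zcard : (#|` Z| <= #|` W| + #|` leaving K (Q j)| + #|` far|)%N.
    rewrite /Z cardfsU (leq_trans (leq_subr _ _)) // leq_add2r.
    by rewrite cardfsU leq_subr.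
  apply: le_lt_trans (_ : (#|` W| + #|` leaving K (Q j)| + #|` far|)%:R < _).
    by rewrite ler_nat.
  have Qj : J3%:R <= #|` Q j|%:R :> R.
    by rewrite ler_nat (leq_trans J3j) // increasing_card.
  have Wlt : #|` W|%:R < c / 4 * #|` Q j|%:R.
    by apply: lt_le_trans J3W _; rewrite ler_pM2l.
  have Llt := leave j J2j.
  have farlt : #|` far|%:R < c / 4 * #|` Q j|%:R.
    have -> : #|` far|%:R = count_event (R := R) (Q j) (long_edge e M) omega.
      by rewrite count_eventE.
    apply: lt_trans long_lt _.
    by rewrite ltr_pM2r // ltr0n Q_card_gt0.
  have q0 : 0 < c * #|` Q j|%:R by rewrite mulr_gt0 // ltr0n Q_card_gt0.
  rewrite !natrD; lra.
have bdZ y : y \in Q j -> boundary omega (Q j) y -> y \in Z.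
  move=> yQ [x xQ yx]; rewrite !inE yQ /=.
  have [|lt_M] := leqP M (e' (x * y^-1)%g) => [le_M|].
    apply/orP; right; apply/mem_set; exists (e' (x * y^-1)%g).
      by rewrite /= => lt_M; have := leq_ltn_trans le_M lt_M; rewrite ltnn.
    by rewrite /= eK mulgVK adjC.
  apply/orP; left; apply/orP; right; apply/allPn; exists (x * y^-1)%g; last by rewrite mulgVK.
  by apply/imfsetP; exists (e' (x * y^-1)%g); rewrite ?eK //= mem_iota.
have [f [f0 fQ fZ eigen]] := eigenfunction_vanishing lf bdZ Zlt.
exists f; split; last by move=> x xW; apply: fZ; rewrite !inE xW.
split => //; apply: sub_finite_set (finite_fset (Q j)) => x /= fx.
by apply: contraNT fx => /fQ ->.
Qed.

(** If [N] were continuous at [la], then for almost every configuration the multiplicity would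
eventually be too small for a proportion q / 4 of good translates of the pattern, hence the pattern
would be absent at a proportion at least 1 - q / 2 of the points of Q_j for all large j. This has
probability at most (1 - q) / (1 - q / 2) < 1. *)
Lemma eigenfunction_discontinuous (Pr : probability (Omega G) R) (p : G -> R)
    (omega0 : configuration G) la f :
  (forall x, p x = p x^-1%g) -> product_measure p Pr -> countable [set: G] ->
  {ae Pr, forall omega, locally_finite omega /\ ids_limit omega} ->
  locally_finite omega0 ->
  (forall B U, Pr (pattern B U 1%g) = 0%E -> ~ pattern B U 1%g omega0) ->
  eigenfunction omega0 la f -> ~ {for la, continuous N}.
Proof.
move=> p_sym PrP countG good lf0 no_null [f_fin f0 eigen] cont.
pose B : {fset G} := fset_set [set x | f x != 0].
have fB x : x \notin B -> f x = 0.
  move=> xB; apply/eqP/negPn; apply: contra xB => fx.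
  by rewrite in_fset_set //; exact/mem_set.
have [U pat0] := pattern_exists B lf0.
have mpat t := measurable_pattern countG B U t.
have [q q01 PrU] : exists2 q : R, 0 < q <= 1 & Pr (pattern B U 1%g) = q%:E.
  exists (fine (Pr (pattern B U 1%g))); last by rewrite fineK // fin_num_measure.
  rewrite -!lte_fin -lee_fin fineK ?fin_num_measure // probability_le1 // andbT.
  by rewrite lt_neqAle measure_ge0 andbT eq_sym; apply/eqP => /no_null.
have q0 : 0 < q by case/andP: q01.
have q1 : q <= 1 by case/andP: q01.
pose D t : set (Omega G) := ~` pattern B U t.
have mD t : measurable (D t) by exact: measurableC.
have PrD t : (Pr (D t) <= (1 - q)%:E)%E.
  by rewrite probability_setC // (Pr_pattern_shift p_sym PrP) // PrU.
have e0 : 0 < 1 - q / 2 by lra.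
pose C j : set (Omega G) := [set omega | (1 - q / 2) * #|` Q j|%:R <= count_event (Q j) D omega].
have mC j : measurable (C j) by exact: measurable_count_ge.
have PrC : (Pr (eventually_event C) <= ((1 - q) / (1 - q / 2))%:E)%E.
  apply: measure_eventually_le => //; apply: nearW => j.
  by apply: markov_count => //; have [] := Q_folner.
have [Z [mZ Z0 subZ]] := good.
have goodC : ~` Z `<=` eventually_event C.
  move=> omega nZ; have [lf idsN] : locally_finite omega /\ ids_limit omega.
    by apply: contrapT => bad; apply: nZ; exact: subZ.
  pose b : R := (#|` B| ^ 2).+1%:R.
  have b0 : 0 < b by rewrite ltr0n.
  have c0 : 0 < q / 4 / b by rewrite !divr_gt0.
  have [J1 _ mult_lt] := continuous_multiplicity Q_card_gt0 idsN cont c0.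
  have q4 : 0 < q / 4 by rewrite divr_gt0.
  have [J2 _ leave] := folner_leaving B Q_folner q4.
  exists (maxn J1 J2) => // j /=; rewrite geq_max => /andP[J1j J2j].
  rewrite /C /= leNgt; apply/negP; rewrite count_eventE.
  set bad := [fset t in Q j | _]%fset => bad_lt.
  pose T := (Q j `\` (leaving B (Q j) `|` bad))%fset.
  have Tpat t : t \in T -> pattern B U t omega.
    rewrite !inE => /andP[+ tQ]; rewrite tQ /= negb_or => /andP[_] tbad.
    by apply: contrapT => npat; move/negP: tbad; apply; exact/mem_set.
  have TQ t x : t \in T -> x \in B -> (x * t)%g \in Q j.
    move=> /[!inE] /andP[+ tQ] xB; rewrite tQ /= negb_or negbK => /andP[/allP + _]; exact.
  have Tle := multiplicity_ge (R := R) lf lf0 fB f0 eigen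
    (fun t tT => pattern_looks_like (Tpat t tT) pat0) TQ.
  have Qle : (#|` Q j| <= #|` leaving B (Q j)| + #|` bad| + #|` T|)%N.
    rewrite -(cardfsID (leaving B (Q j) `|` bad)%fset (Q j)) leq_add2r.
    apply: (@leq_trans #|` leaving B (Q j) `|` bad|%fset); last by rewrite cardfsU leq_subr.
    by rewrite fsubset_leq_card // fsubsetIr.
  have Tlt : #|` T|%:R <= q / 4 * #|` Q j|%:R.
    apply: (@le_trans _ _ (b * (q / 4 / b * #|` Q j|%:R))); last first.
      by rewrite mulrA mulrC [b * _]mulrC divfK ?gt_eqF // mulrC.
    apply: (@le_trans _ _ (b * (multiplicity (laplacian_mx R omega (Q j)) la)%:R)).
      by rewrite /b -natrM ler_nat (leq_trans Tle) // leq_mul2r leqnSn orbT.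
    by rewrite ler_pM2l // ltW // mult_lt.
  have := leave j J2j; move: Qle; rewrite -(ler_nat R) !natrD.
  have := Q_card_gt0 j; rewrite -(ltr0n R).
  move: bad_lt Tlt; set a := #|` bad|%:R; set s := #|` Q j|%:R.
  set l := #|` leaving _ _|%:R; set u := #|` T|%:R.
  (* Q_j is covered by three parts, which would take up less than 1 - q / 2, at most q / 4 and
     at most q / 4 of it. *)
  move=> bad_lt T_le s0 Q_le leaving_le.
  have : 0 < q * s by rewrite mulr_gt0.
  lra.
have : (Pr (~` Z) <= Pr (eventually_event C))%E.
  by apply: le_measure; rewrite ?inE //; [exact: measurableC | exact: measurable_eventually].
rewrite probability_setC // Z0 sube0 => H; have := le_trans H PrC.
by rewrite lee_fin ler_pdivlMr // mul1r; lra.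
Qed.
End SpectralEquivalence.

Lemma eigenfunctionE (R : realType) (G : groupType) (omega : configuration G)
    (A : operator R G) la f : is_laplacian omega A ->
  finitely_supported_eigenfunction A la f <-> eigenfunction omega la f.
Proof.
move=> [_ ext]; split=> [[fin f0 domf eigen]|[fin f0 eigen]].
  by split => //; rewrite -(ext f fin).2.
by have [domf appf] := ext f fin; split => //; rewrite appf.
Qed.

Theorem theorem6p1 (R : realType) (G : groupType) (S : {fset G})
    (hS : symmetric_generating_set S)
    (hG : amenable R G)
    (Q : nat -> {fset G})
    (hQ_folner : folner R Q)
    (hQ_tempered : tempered R Q)
    (hQ_increasing : strictly_increasing Q)
    (hQ_monotile : forall n, monotile (Q n))
    (p : G -> R)
    (hp_l1 : esum.summable [set: G] (EFin \o p))
    (hp01 : forall x, 0 <= p x <= 1)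
    (hp_sym : forall x, p x = p (x^-1)%g)
    (Pr : probability (Omega G) R)
    (hPr : product_measure p Pr)
    (Delta : Omega G -> operator R G)
    (hDelta : forall omega, locally_finite omega ->
                is_laplacian omega (Delta omega))
    (N : R -> R)
    (hN : integrated_density_of_states Q Pr N) :
  exists Omega' : set (Omega G),
    [/\ measurable Omega', Pr Omega' = 1%E &
      forall omega, Omega' omega ->
        locally_finite omega /\
        forall lambda : R,
          let a := ~ {for lambda, continuous N} in
          let b := exists f : G -> R[i],
            finitely_supported_eigenfunction (Delta omega) lambda f in
          let c := exists f : nat -> G -> R[i],
            (forall k, finitely_supported_eigenfunction
                         (Delta omega) lambda (f k)) /\
            linearly_independent f in
          (a <-> b) /\ (b <-> c)].
Proof.
have countG := generated_countable hS.
have [e e_bij] := exists_enumeration countG (increasing_infinite hQ_increasing).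
have p_ge0 x : 0 <= p x by case/andP: (hp01 x).
have Q0 := hQ_folner.1.
have aeL := ae_locally_finite hp_sym p_ge0 hPr e_bij hp_l1 countG.
have aeF := ae_few_long_edges hp_sym p_ge0 hPr e_bij hp_l1 Q0.
have aeP := ae_pattern Pr countG.
have good : {ae Pr, forall omega, locally_finite omega /\ ids_limit Q N omega}.
  exact: ae_and aeL hN.
have [Z [mZ Z0 subZ]] := ae_and good (ae_and aeF aeP).
exists (~` Z); split; first exact: measurableC.
  by rewrite probability_setC // Z0 sube0.
move=> omega nZ.
have [[lf idsN] [few no_null]] := contrapT (fun bad => nZ (subZ _ bad)).
split => // la a b c.
have lapl := hDelta _ lf.
have ac : a -> c.
  move=> disc.
  have [f [f_eigen f_indep]] :=
    discontinuous_eigenfunctions hQ_folner hQ_increasing e_bij lf idsN few disc.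
  by exists f; split => // k; apply/(eigenfunctionE la (f k) lapl).
have cb : c -> b by move=> [f [f_eigen _]]; exists (f 0%N).
have ba : b -> a.
  move=> [f /(eigenfunctionE la f lapl) f_eigen].
  exact: (eigenfunction_discontinuous hQ_folner hp_sym hPr countG good lf no_null f_eigen).
by split; split; [move=> /ac/cb | exact: ba | move=> /ba/ac | exact: cb].
Qed.
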